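(* Let $X$ be a reflexive Banach space and let $T$ be a bounded linear operator on $X$ such that (i) for every nonempty norm open set $G\subseteq X$ and every nonempty weakly open set $W\subseteq X$, there is some integer $n\ge 0$ such that $T^nG\cap W\neq\emptyset$; (ii) there exists some integer $M$ such that, whenever $G\subseteq X$ is a norm open set with $G\cap \mathrm{Ball}(X)\neq\emptyset$ and $W\subseteq X$ is a weakly open set with $W\cap \mathrm{Ball}(X)\neq\emptyset$, there is some integer $n\ge 0$ such that $$T^n\bigl(G\cap \mathrm{Ball}(X)\bigr)\cap W\cap \mathrm{Ball}_M(X)\neq\emptyset .$$ Then $T$ is weakly hypercyclic.
   Context: For an integer $N$, $\mathrm{Ball}_N(X)=\{x\in X:\|x\|\le N\}$, and $\mathrm{Ball}(X)=\mathrm{Ball}_1(X)$ is the closed unit ball of $X$. The orbit of $x\in X$ under $T$ is $\mathrm{Orb}(T,x)=\{T^nx : n\ge 0\}$. The operator $T$ is weakly hypercyclic if there is a vector $x\in X$ whose orbit $\mathrm{Orb}(T,x)$ is dense in $X$ with respect to the weak topology of $X$. ''Norm open'' and ''weakly open'' refer to the norm topology and the weak topology of $X$.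
   Formalization: The space X is additionally assumed to be norm separable; without this the claim fails, e.g. for twice the backward shift on l2(H) with H a nonseparable Hilbert space, and separability is necessary for weak hypercyclicity. *)

(* Defs.v *)
From HB Require Import structures.
From mathcomp Require Import all_boot all_order all_algebra.
From mathcomp Require Import complex.
From mathcomp Require Import all_classical all_reals all_analysis.

Set Implicit Arguments.
Unset Strict Implicit.
Unset Printing Implicit Defensive.

Import Order.TTheory GRing.Theory Num.Theory.
Import numFieldNormedType.Exports.

Local Open Scope classical_set_scope.
Local Open Scope ring_scope.

Definition separable (T : topologicalType) : Prop :=
  exists2 A : set T, countable A & dense A.

Section Dual.
Variables (K : numFieldType) (X : normedModType K).

Definition dual_pred : {pred X -> K^o} :=
  [pred f : X -> K^o | `[< linear f /\ continuous f >]].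

Lemma dual_predP (f : X -> K^o) :
  reflect (linear f /\ continuous f) (f \in dual_pred).
Proof. by rewrite inE; exact: asboolP. Qed.

Lemma dual_submod_closed : submod_closed dual_pred.
Proof.
split=> [|a f g /dual_predP[lf cf] /dual_predP[lg cg]]; apply/dual_predP.
  split=> [b x y|]; last exact: cst_continuous.
  by rewrite /= scaler0 addr0.
split=> [b x y|x].
  have appE z : (a *: f + g) z = a *: f z + g z by [].
  rewrite !appE lf lg.
  by rewrite !scalerDr addrACA !scalerA [a * b]mulrC.
by apply: cvgD; [apply: cvgZr; exact: cf|exact: cg].
Qed.

HB.instance Definition _ :=
  GRing.isSubmodClosed.Build K (X -> K^o) dual_pred dual_submod_closed.

Record dual := Dual { dual_fun :> X -> K^o; _ : dual_fun \in dual_pred }.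

HB.instance Definition _ := [isSub for dual_fun].
HB.instance Definition _ := [Choice of dual by <:].
HB.instance Definition _ := [SubChoice_isSubLmodule of dual by <:].

(* [f] has dual norm at most 1; stated pointwise because the norm of [X] takes
   its values in [K], where suprema are not available in general. *)
Definition dual_unit_ball : set dual := [set f | forall x, `|f x| <= `|x|].

Definition in_bidual (phi : {linear dual -> K^o}) : Prop :=
  exists C : K, forall f, dual_unit_ball f -> `|phi f| <= C.

(* Surjectivity of the canonical map from [X] to its bidual. *)
Definition reflexive_space : Prop :=
  forall phi : {linear dual -> K^o}, in_bidual phi ->
  exists x : X, forall f : dual, phi f = f x.

Definition weak_topology : topologicalType :=
  sup_topology (fun f : dual =>
    Topological.on (initial_topology (f : X -> K^o))).

Definition weakly_open (W : set X) : Prop := @open weak_topology W.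

Definition weakly_dense (A : set X) : Prop := @dense weak_topology A.

Definition Ball (N : int) : set X := [set x | `|x| <= N%:~R].

Definition Orb (T : X -> X) (x : X) : set X := range (fun n => iter n T x).

Definition weakly_hypercyclic (T : X -> X) : Prop :=
  exists x, weakly_dense (Orb T x).

End Dual.
Arguments reflexive_space {K} X.
Arguments Ball {K} X N.

(* Main.v *)
Require Import Defs.
From HB Require Import structures.
From mathcomp Require Import all_boot all_order all_algebra.
From mathcomp Require Import complex.
From mathcomp Require Import all_classical all_reals all_analysis.
From mathcomp Require Import ring lra.

Set Implicit Arguments.
Unset Strict Implicit.
Unset Printing Implicit Defensive.

Import Order.TTheory GRing.Theory Num.Theory.
Import numFieldNormedType.Exports.

Local Open Scope classical_set_scope.
Local Open Scope ring_scope.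

(** Scaling the second transitivity condition by [c] gives, for every radius
    [c], the same condition on the ball of radius [c]: an open set [G] and a
    weakly open set [W] that both meet this ball admit [x] in [G] and [n] with
    [T^n x] in [W] and [|T^n x| <= c * M] ([ball_transitive_scaled]). The bound
    on [T^n x] makes it possible to replace [W] by any weakly open set contained
    in [W] up to that bound, and the weak topology of a bounded set has a
    countable base. For each member of such a base, and each integer radius
    [c >= 1] of a ball that it meets, the set of [x] whose orbit hits it within
    the bound is norm open up to enlarging the bound by 1, and meets every
    nonempty open subset of the unit ball. The Baire
    category theorem ([archimedean_baire]) gives one [x] in all these sets, and
    its orbit is weakly dense.

    The countable family comes from the separability of the dual. For a dense
    sequence [a], choose [z k] in the dual unit ball that norms [a k] up to a
    factor 2. A point killed by all [z k] is killed by every functional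
    ([almost_norming_total]), so by reflexivity the span of the [z k] is norm
    dense in the dual ([reflexive_approximation]). On bounded sets the cylinders
    [|z j (x - y)| < d], for finitely many [j], therefore form a basis of weak
    neighbourhoods ([bounded_weak_nbhs]), and it suffices to take [y] among the
    [a k] and [d] of the form [1 / (n + 1)].

    The density of the span rests on a Hahn-Banach theorem for a seminorm on the
    dual, the distance to the span. Its real form [real_hahn_banach] follows from
    the fact that a minimal sublinear functional is linear. *)

(** * Sublinear functionals and the Hahn-Banach theorem *)

Section SublinearFunctionals.
Variables (R : realType) (V : lmodType R).
Implicit Types (p q : V -> R) (x y v : V).

Definition sublinear p :=
  (forall x y, p (x + y) <= p x + p y) /\
  (forall c x, 0 < c -> p (c *: x) <= c * p x).

Lemma sublinear0 p : sublinear p -> p 0 = 0.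
Proof.
move=> [_ pZ].
have := pZ 2 0 ltac:(lra); have := pZ 2^-1 0 ltac:(lra).
by rewrite !scaler0; lra.
Qed.

Lemma sublinearZ p c x : sublinear p -> 0 <= c -> p (c *: x) = c * p x.
Proof.
move=> sp; rewrite le_eqVlt => /predU1P[<-|c0].
  by rewrite scale0r mul0r sublinear0.
apply/eqP; rewrite eq_le sp.2//= mulrC -ler_pdivlMr// mulrC.
have /(sp.2 _ (c *: x)) : 0 < c^-1 by rewrite invr_gt0.
by rewrite scalerA mulVf ?gt_eqF// scale1r.
Qed.

Lemma sublinear_geN p x : sublinear p -> - p (- x) <= p x.
Proof.
by move=> sp; rewrite -subr_ge0 opprK -(sublinear0 sp) -(subrr x); exact: sp.1.
Qed.

(** This lowering of [p] satisfies [inf_shift p y x <= p (x + y) - p y], so a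
    [p] that it does not change is superadditive in the direction [y]. *)
Definition inf_shift p y x : R :=
  inf [set r | exists2 t, 0 <= t & r = p (x + t *: y) - t * p y].

Lemma inf_shift_le p y x t : sublinear p -> 0 <= t ->
  inf_shift p y x <= p (x + t *: y) - t * p y.
Proof.
move=> sp t0; apply: ge_inf; last by exists t.
exists (- p (- x)) => _ [s s0 ->].
rewrite -sublinearZ//; have := sp.1 (x + s *: y) (- x).
by rewrite addrAC subrr add0r; lra.
Qed.

Lemma le_inf_shift p y x b :
  (forall t, 0 <= t -> b <= p (x + t *: y) - t * p y) ->
  b <= inf_shift p y x.
Proof.
move=> bl; apply: lb_le_inf => [|_ [t t0 ->]]; last exact: bl.
by eexists; exists 0.
Qed.

Lemma inf_shift_le_self p y x : sublinear p -> inf_shift p y x <= p x.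
Proof.
move=> sp; have := @inf_shift_le p y x 0 sp (lexx _).
by rewrite scale0r addr0 mul0r subr0.
Qed.

Lemma inf_shift_sublinear p y : sublinear p -> sublinear (inf_shift p y).
Proof.
move=> sp; split=> [x1 x2|c x c0].
  rewrite -lerBlDr; apply: le_inf_shift => s s0.
  rewrite lerBlDr -lerBlDl; apply: le_inf_shift => t t0.
  have := @inf_shift_le p y (x1 + x2) (s + t) sp (addr_ge0 s0 t0).
  have := sp.1 (x1 + s *: y) (x2 + t *: y).
  by rewrite addrACA -scalerDl; lra.
rewrite mulrC -ler_pdivrMr//; apply: le_inf_shift => t t0.
rewrite ler_pdivrMr// mulrBl -[_ * p y * c]mulrAC [_ * c]mulrC.
rewrite -(sublinearZ (x + _) sp (ltW c0)) scalerDr scalerA [t * c]mulrC.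
by apply: inf_shift_le => //; rewrite mulr_ge0// ltW.
Qed.

Definition inf_family (A : set (V -> R)) x : R := inf [set q x | q in A].

(** Subadditivity survives the infimum because, of any two members of the
    chain, the smaller one bounds both terms. The common bound [p] keeps the
    infimum finite: a sublinear [q <= p] has [q x >= - q (- x) >= - p (- x)]. *)
Lemma inf_family_sublinear p (A : set (V -> R)) :
  A !=set0 ->
  (forall q, A q -> sublinear q /\ forall x, q x <= p x) ->
  (forall q r, A q -> A r ->
     (forall x, q x <= r x) \/ (forall x, r x <= q x)) ->
  sublinear (inf_family A) /\ forall q x, A q -> inf_family A x <= q x.
Proof.
move=> [q0 Aq0] Ap Atot.
have infle q x : A q -> inf_family A x <= q x.
  move=> Aq; apply: ge_inf; last by exists q.
  exists (- p (- x)) => _ [r Ar <-].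
  apply: le_trans (sublinear_geN x (Ap _ Ar).1).
  by rewrite lerN2; apply: (Ap _ Ar).2.
have leinf b x : (forall q, A q -> b <= q x) -> b <= inf_family A x.
  move=> bl; apply: lb_le_inf => [|_ [q Aq <-]]; last exact: bl.
  by exists (q0 x), q0.
split=> //; split=> [x y|c x c0].
  rewrite -lerBlDr; apply: (leinf) => q Aq.
  rewrite lerBlDr -lerBlDl; apply: (leinf) => r Ar.
  rewrite lerBlDl.
  have [qr|rq] := Atot _ _ Aq Ar.
    apply: le_trans (infle _ _ Aq) _; apply: le_trans ((Ap _ Aq).1.1 _ _) _.
    by rewrite lerD2l qr.
  apply: le_trans (infle _ _ Ar) _; apply: le_trans ((Ap _ Ar).1.1 _ _) _.
  by rewrite lerD2r rq.
rewrite mulrC -ler_pdivrMr//; apply: (leinf) => q Aq.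
by rewrite ler_pdivrMr// mulrC (le_trans (infle _ _ Aq))// (Ap _ Aq).1.2.
Qed.

Lemma exists_minimal_sublinear p : sublinear p ->
  exists q, [/\ sublinear q, forall x, q x <= p x &
    forall r, sublinear r -> (forall x, r x <= q x) -> r = q].
Proof.
move=> sp.
pose S := {q : V -> R | sublinear q /\ forall x, q x <= p x}.
pose ge (q r : S) := `[< forall x, sval r x <= sval q x >].
have [||||[q [sq qp]] qmin] := @Zorn S ge.
- by move=> q; apply/asboolP.
- move=> q r s /asboolP qr /asboolP rs; apply/asboolP => x.
  exact: le_trans (rs x) (qr x).
- move=> [q hq] [r hr] /asboolP/= qr /asboolP/= rq; apply: eq_exist.
  by apply/funext => x; apply/eqP; rewrite eq_le qr rq.
- move=> A Atot.
  have [[q0 Aq0]|A0] := pselect (A !=set0); last first.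
    pose m : S := exist _ p (conj sp (fun x => lexx _)); exists m => s As.
    by exfalso; apply: A0; exists s.
  have [||q r [s As <-] [t At <-]|sA Ale] :=
      @inf_family_sublinear p [set sval q | q in A].
  + by exists (sval q0), q0.
  + by move=> _ [s As <-]; exact: (svalP s).
  + by case: (Atot _ _ As At) => /asboolP; [right|left].
  have Ap x : inf_family [set sval q | q in A] x <= p x.
    apply: le_trans (Ale (sval q0) x _) ((svalP q0).2 x).
    by exists q0.
  pose m : S := exist _ (inf_family [set sval q | q in A]) (conj sA Ap).
  exists m => s As; apply/asboolP => x /=.
  by apply: Ale; exists s.
exists q; split=> // r sr rq.
have rp x : r x <= p x := le_trans (rq x) (qp x).
by apply: (congr1 sval (qmin (exist _ r (conj sr rp)) _)); apply/asboolP.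
Qed.

(** Minimality forces [inf_shift q y = q] for every [y], hence [q] is
    superadditive; together with subadditivity it is additive, and then its
    positive homogeneity extends to negative scalars. *)
Lemma minimal_sublinear_scalar q : sublinear q ->
  (forall r, sublinear r -> (forall x, r x <= q x) -> r = q) -> scalar q.
Proof.
move=> sq qmin.
have qD x y : q (x + y) = q x + q y.
  apply/eqP; rewrite eq_le sq.1/=.
  have := @inf_shift_le q y x 1 sq ler01; rewrite scale1r mul1r.
  rewrite (qmin (inf_shift q y)) ?lerBrDr//; first exact: inf_shift_sublinear.
  by move=> z; exact: inf_shift_le_self.
have qN x : q (- x) = - q x.
  by have := qD x (- x); rewrite subrr sublinear0//; lra.
move=> c x y; rewrite qD; congr (_ + _).
have [c0|/ltW c0] := leP 0 c; first exact: sublinearZ.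
rewrite -[c in LHS]opprK scaleNr qN sublinearZ ?oppr_ge0//.
by rewrite mulNr opprK.
Qed.

(** Any minimal sublinear functional below [inf_shift p v] works: it is linear,
    and its value at [- v] is at most [p 0 - p v = - p v], so that its value at
    [v] is at least [p v]. *)
Theorem real_hahn_banach p v : sublinear p ->
  exists f : V -> R, [/\ scalar f, forall x, f x <= p x & f v = p v].
Proof.
move=> sp.
have [f [sf fp fmin]] := exists_minimal_sublinear (inf_shift_sublinear v sp).
have fs := minimal_sublinear_scalar sf fmin.
have flep x : f x <= p x := le_trans (fp x) (inf_shift_le_self v x sp).
exists f; split=> //; apply/eqP; rewrite eq_le flep/=.
have := le_trans (fp (- v)) (inf_shift_le v (- v) sp ler01).
rewrite scale1r addNr sublinear0// mul1r sub0r.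
have := fs (-1) v 0; rewrite addr0 scaleN1r sublinear0// addr0 mulN1r => ->.
by rewrite lerN2.
Qed.

End SublinearFunctionals.

(** * Real and complex scalars *)

(** A type alias, so that the real scaling does not compete with the complex one
    in the search for the module structure of [V]. *)
Definition realify (R : realType) (V : lmodType R[i]%C) : Type := V.

Section RestrictionOfScalars.
Variables (R : realType) (V : lmodType R[i]%C).

HB.instance Definition _ := GRing.Zmodule.on (realify V).

Let scale (c : R) (x : realify V) : realify V := (c%:C)%C *: (x : V).

Let scaleA a b x : scale a (scale b x) = scale (a * b) x.
Proof. by rewrite /scale scalerA rmorphM. Qed.

Let scale1 : left_id 1 scale.
Proof. by move=> x; rewrite /scale rmorph1 scale1r. Qed.

Let scaleDr : right_distributive scale +%R.
Proof. by move=> c x y; rewrite /scale scalerDr. Qed.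

Let scaleDl x : {morph scale^~ x : a b / a + b}.
Proof. by move=> a b; rewrite /scale rmorphD scalerDl. Qed.

HB.instance Definition _ :=
  GRing.Zmodule_isLmodule.Build R (realify V) scaleA scale1 scaleDr scaleDl.

Lemma realify_scaleE (c : R) (x : realify V) : c *: x = (c%:C)%C *: (x : V).
Proof. by []. Qed.

End RestrictionOfScalars.

Section Scalars.
Variables (R : realType) (K : numFieldType).
Hypothesis real_or_complex :
  K = R :> numFieldType \/ K = R[i]%C :> numFieldType.

Lemma scalar_archimedean (x : K) : exists n : nat, `|x| < n%:R.
Proof.
case: real_or_complex x => -> x.
  by exists (Num.truncn `|x|).+1; exact: truncnS_gt.
exists (Num.truncn (complex.Re `|x|)).+1.
have -> : `|x| = ((complex.Re `|x|)%:C)%C by rewrite RRe_real ?normr_real.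
by rewrite -(rmorph_nat (real_complex R)) ltcR; exact: truncnS_gt.
Qed.

(** Norms take their values in [K], which has only a partial order in the complex
    case; the nonnegative part of [K] is nevertheless that of [R]. *)
Lemma scalar_glb (S : set K) : S !=set0 -> (forall s, S s -> 0 <= s) ->
  exists m, lbound S m /\ forall b, lbound S b -> b <= m.
Proof.
case: real_or_complex S => -> S [s0 Ss0] S0.
  exists (inf S); split=> [s Ss|b bS]; last first.
    by apply: lb_le_inf => //; exists s0.
  by apply: ge_inf => //; exists 0 => s' /S0.
have imS s : S s -> complex.Im s = 0 by move=> /S0/ger0_Im.
exists ((inf [set complex.Re s | s in S])%:C)%C; split=> [s Ss|b bS].
  rewrite lecE imS//= eqxx/=; apply: ge_inf; last by exists s.
  by exists 0 => _ [s' /S0 + <-]; rewrite lecE => /andP[].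
have := bS _ Ss0; rewrite lecE imS// => /andP[/eqP b0 _].
rewrite lecE/= b0 eqxx/=; apply: lb_le_inf; first by exists (complex.Re s0), s0.
by move=> _ [s Ss <-]; have := bS _ Ss; rewrite lecE => /andP[].
Qed.

(** If the supremum is positive, then some member exceeds half of it; if it is 0,
    then every member is 0. *)
Lemma scalar_half_sup (S : set K) (b : K) : S !=set0 ->
  (forall s, S s -> 0 <= s <= b) ->
  exists2 s, S s & forall t, S t -> t <= 2 * s.
Proof.
move=> [s0 Ss0] Sb.
have S0 s : S s -> 0 <= s by move=> /Sb/andP[].
have [|u Su|c [cS clb]] := @scalar_glb (ubound S).
- by exists b => s /Sb/andP[].
- exact: le_trans (S0 _ Ss0) (Su _ Ss0).
have Sc s : S s -> s <= c by move=> Ss; apply: clb => u; exact.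
have c0 : 0 <= c := le_trans (S0 _ Ss0) (Sc _ Ss0).
have [[s [Ss cs]]|small] := pselect (exists s, S s /\ c <= 2 * s).
  by exists s => // t /Sc/le_trans; exact.
exists s0 => // t St.
have : c <= c / 2.
  apply: cS => s Ss; rewrite ler_pdivlMr// mulrC.
  case: (real_leP (ger0_real c0) (ger0_real (mulr_ge0 (ler0n _ 2) (S0 _ Ss)))).
    by move=> cs; case: small; exists s.
  exact: ltW.
rewrite ler_pdivlMr// mulr_natr mulr2n -lerBrDr subrr => cle0.
by rewrite (le_trans (le_trans (Sc _ St) cle0))// mulr_ge0// S0.
Qed.

(** In the complex case, take a real linear [u <= q] with [u v = q v] and put
    [f x = u x - 'i * u ('i *: x)]. The triangle inequality gives the factor 2,
    which a rotation of [x] would remove; any constant serves below. *)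
Theorem seminorm_hahn_banach (V : lmodType K) (q : V -> K) v :
  (forall x, 0 <= q x) -> (forall x y, q (x + y) <= q x + q y) ->
  (forall c x, q (c *: x) <= `|c| * q x) -> 0 < q v ->
  exists f : V -> K^o, [/\ linear f, forall x, `|f x| <= 2 * q x & f v != 0].
Proof.
case: real_or_complex V q v => -> V q v q0 qD qZ qv.
  have [|f [fs fq fv]] := @real_hahn_banach R V q v.
    by split=> // c x c0; rewrite (le_trans (qZ _ _))// gtr0_norm.
  have fN x : f (- x) = - f x.
    have f0 : f 0 = 0 by have := fs (-1) 0 0; rewrite scaler0 addr0; lra.
    by have := fs (-1) x 0; rewrite addr0 scaleN1r f0 addr0 mulN1r.
  exists f; split=> //; last by rewrite fv gt_eqF.
  move=> x; rewrite ler_norml; have := fq x; have := fq (- x); have := q0 x.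
  have := qZ (-1) x; rewrite scaleN1r normrN1 mul1r fN; lra.
pose p (x : realify V) : R := complex.Re (q x).
have qp x : q x = ((p x)%:C)%C by rewrite RRe_real// ger0_real.
have pZ c x : p (c *: (x : V)) <= complex.Re `|c| * p x.
  have := qZ c x; rewrite !qp -[`|c|]RRe_real ?normr_real//.
  by rewrite -rmorphM lecR.
have p0 x : 0 <= p x by have := q0 x; rewrite qp ler0c.
have [|u [us up uv]] := @real_hahn_banach R (realify V) p v.
  split=> [x y|c x c0]; first by rewrite -lecR rmorphD/= -!qp.
  rewrite realify_scaleE (le_trans (pZ _ _))// normc_def/=.
  by rewrite expr0n/= addr0 sqrtr_sqr gtr0_norm.
have u0 : u 0 = 0 by have := us (-1) 0 0; rewrite scaler0 addr0; lra.
have uZ c x : u (c *: x) = c * u x.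
  by have := us c x 0; rewrite addr0 u0 addr0.
have uD x y : u (x + y) = u x + u y by have := us 1 x y; rewrite scale1r mul1r.
have normu x : `|(u x)%:C%C| <= q x.
  rewrite qp normc_def/= expr0n/= addr0 sqrtr_sqr lecR ler_norml up andbT.
  rewrite lerNl -mulN1r -uZ (le_trans (up _))// realify_scaleE.
  rewrite (le_trans (pZ _ _))// normc_def/= expr0n/= addr0 sqrrN expr1n.
  by rewrite sqrtr1 mul1r.
(* The unique complex linear form whose real part is [u]. *)
pose f (x : V) : (R[i]%C)^o := (u x +i* - u ('i *: x))%C.
exists f; split=> [[a b] x y|x|].
- have uZC (z : V) : u ((a +i* b)%C *: z) = a * u z + b * u ('i%C *: z).
    have -> : (a +i* b)%C *: z = (a%:C)%C *: z + (b%:C)%C *: ('i%C *: z).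
      rewrite scalerA -scalerDl; congr (_ *: _).
      by apply/eqP; rewrite eq_complex /=; apply/andP; split; apply/eqP; ring.
    by rewrite -!uZ -uD.
  have iZ : 'i%C *: ((a +i* b)%C *: x + y) =
      (a +i* b)%C *: ('i%C *: x) + 'i%C *: y.
    by rewrite scalerDr !scalerA mulrC.
  have ii : 'i%C *: ('i%C *: x) = - x by rewrite scalerA -expr2 sqr_i scaleN1r.
  have uN : u (- x) = - u x by have := uZ (-1) x; rewrite scaleN1r mulN1r.
  apply/eqP; rewrite eq_complex/= iZ !uD !uZC ii uN.
  by apply/andP; split; apply/eqP; ring.
- have -> : f x = ((u x)%:C - 'i * (u ('i *: x))%:C)%C.
    by apply/eqP; rewrite eq_complex/=; apply/andP; split; apply/eqP; ring.
  have i1 : `|'i%C : R[i]%C| = 1.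
    by rewrite normc_def/= expr0n/= add0r expr1n sqrtr1.
  rewrite (le_trans (ler_normB _ _))// normrM i1 mul1r mulr2n mulrDl mul1r.
  apply: lerD => //; apply: le_trans (normu _) _.
  by rewrite (le_trans (qZ _ _))// i1 mul1r.
- by apply/eqP => -[/eqP]; rewrite uv; move: qv; rewrite qp ltcR => /gt_eqF ->.
Qed.
End Scalars.

(** * Approximation in the dual of a reflexive space *)

Section DualFunctionals.
Variables (K : numFieldType) (X : normedModType K).
Implicit Types (f g : dual X) (x y : X).

Lemma dual_linear f : linear f.
Proof. by case: f => f /= /dual_predP[]. Qed.

Lemma dual_continuous f : continuous f.
Proof. by case: f => f /= /dual_predP[]. Qed.

HB.instance Definition _ f :=
  GRing.isLinear.Build K X K^o *:%R (dual_fun f) (dual_linear f).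

Lemma dual_addE f g x : (f + g) x = f x + g x. Proof. by []. Qed.

Lemma dual_scaleE c f x : (c *: f) x = c * f x. Proof. by []. Qed.

Lemma dual_bounded f : exists2 C, 0 < C & forall x, `|f x| <= C * `|x|.
Proof.
have /linear_boundedP : bounded_near f (nbhs 0).
  by apply: continuous_linear_bounded; exact: dual_continuous.
by move=> /pinfty_ex_gt0[C C0 fC]; exists C.
Qed.

End DualFunctionals.

Section Approximation.
Variables (R : realType) (K : numFieldType).
Hypothesis real_or_complex :
  K = R :> numFieldType \/ K = R[i]%C :> numFieldType.
Variable X : normedModType K.
Hypothesis X_reflexive : reflexive_space X.
Variable Y : set (dual X).
Hypotheses (Y0 : Y 0) (YD : forall f g, Y f -> Y g -> Y (f + g))
  (YZ : forall c f, Y f -> Y (c *: f)).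
Hypothesis Y_total : forall x : X,
  (forall g, Y g -> g x = 0) -> forall f : dual X, f x = 0.

Let approx_rates (f : dual X) : set K :=
  [set r | 0 <= r /\ exists2 g, Y g & forall x, `|f x - g x| <= r * `|x|].

(** A subspace of the dual whose common kernel is killed by every functional is
    norm dense. Otherwise the distance to [Y] is a seminorm that is nonzero at
    [f]; a linear form on the dual that it dominates vanishes on [Y] but not at
    [f], and is bounded on the dual unit ball. Reflexivity makes it the
    evaluation at a point of the common kernel of [Y], a contradiction. *)
Theorem reflexive_approximation (f : dual X) (e : K) : 0 < e ->
  exists2 g, Y g & forall x, `|f x - g x| <= e * `|x|.
Proof.
move=> e0.
have rates_neq0 g : approx_rates g !=set0.
  have [C C0 gC] := dual_bounded g; exists C; split; first exact: ltW.
  by exists 0 => // x; rewrite subr0.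
have rates_ge0 g r : approx_rates g r -> 0 <= r by case.
(* [q g] is the distance from [g] to [Y] for the dual norm. *)
have [q qglb] := choice (fun g =>
  scalar_glb real_or_complex (rates_neq0 g) (@rates_ge0 g)).
have qle g r : approx_rates g r -> q g <= r by exact: (qglb g).1.
have leq g b : lbound (approx_rates g) b -> b <= q g by exact: (qglb g).2.
have q0 g : 0 <= q g by apply: (leq) => r; exact: rates_ge0.
have qD g h : q (g + h) <= q g + q h.
  rewrite -lerBlDr; apply: (leq) => r [r0 [g' Yg' rg]].
  rewrite lerBlDr -lerBlDl; apply: (leq) => s [s0 [h' Yh' sh]].
  rewrite lerBlDl; apply: (qle); split; first exact: addr_ge0.
  exists (g' + h') => [|x]; first exact: YD.
  rewrite !dual_addE opprD addrACA (le_trans (ler_normD _ _))//.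
  by rewrite mulrDl lerD.
have qZ c g : q (c *: g) <= `|c| * q g.
  have [->|c0] := eqVneq c 0.
    rewrite normr0 mul0r; apply: (qle); split=> //.
    by exists 0 => // x; rewrite dual_scaleE mul0r subr0 normr0 mul0r.
  rewrite -ler_pdivrMl ?normr_gt0//; apply: (leq) => r [r0 [g' Yg' rg]].
  rewrite ler_pdivrMl ?normr_gt0//; apply: (qle).
  split; first by rewrite mulr_ge0.
  exists (c *: g') => [|x]; first exact: YZ.
  by rewrite !dual_scaleE -mulrBr normrM -mulrA ler_wpM2l.
have [qf0|] := eqVneq (q f) 0; last first.
  move=> qf0; exfalso; have qf : 0 < q f by rewrite lt0r qf0 q0.
  have [phi [lphi phiq /eqP phif]] :=
    seminorm_hahn_banach real_or_complex q0 qD qZ qf.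
  pose Phi := HB.pack_for {linear dual X -> K^o} phi
    (GRing.isLinear.Build K (dual X) K^o *:%R phi lphi).
  have [|x phix] := X_reflexive (phi := Phi).
    exists 2 => g g1; rewrite (le_trans (phiq g))// ler_piMr//.
    by apply: (qle); split=> //; exists 0 => // x; rewrite subr0 mul1r.
  apply: phif; rewrite [phi f]phix; apply: Y_total => g Yg.
  rewrite -phix; apply/eqP; rewrite -normr_le0 (le_trans (phiq g))//.
  rewrite pmulr_rle0//; apply: (qle); split=> //.
  by exists g => // y; rewrite subrr normr0 mul0r.
have /existsNP[r] : ~ lbound (approx_rates f) e.
  by move=> /leq; rewrite qf0 => /(lt_le_trans e0); rewrite ltxx.
move=> /not_implyP[[r0 [g Yg rg]] ner]; exists g => // x.
rewrite (le_trans (rg x))// ler_wpM2r//.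
by case: (real_leP (gtr0_real e0) (ger0_real r0)) ner => // /ltW.
Qed.

End Approximation.

(** * Countable description of the weak topology on bounded sets *)

Lemma norm_lt_open (K : numFieldType) (V : normedModType K)
    (S : topologicalType) (h : S -> V) (c : K) :
  continuous h -> open [set x | `|h x| < c].
Proof.
move=> ch; have [c0|c0] := boolP (0 < c); last first.
  rewrite (_ : [set _ | _] = set0); first exact: open0.
  apply/seteqP; split=> // x /= /(le_lt_trans (normr_ge0 _)).
  exact/negP.
rewrite (_ : [set _ | _] = h @^-1` ball 0 c).
  by apply: open_comp; [move=> x _; exact: ch|exact: ball_open].
by apply/seteqP; split=> x /=; rewrite -ball_normE/= sub0r normrN.
Qed.

Lemma norm_gt_open (K : numFieldType) (V : normedModType K) (c : K) :
  open [set x : V | c < `|x|].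
Proof.
rewrite openE => x /= cx; apply/nbhs_ballP; exists (`|x| - c) => /=.
  by rewrite subr_gt0.
move=> y; rewrite -ball_normE/= ltrBrDl -ltrBrDr => /lt_le_trans; apply.
by rewrite lerBlDr -{1}[x](subrK y) addrC ler_normD.
Qed.

Lemma separable_dense_sequence (K : numFieldType) (X : normedModType K) :
  separable X ->
  exists a : nat -> X, forall x (e : K), 0 < e -> exists k, `|x - a k| < e.
Proof.
move=> [A /countable_injP[i inji] densA].
exists (fun k => xget 0 [set x | A x /\ i x = k]) => x e e0.
have [||y [xy Ay]] := densA (ball x e); first by exists x; exact: ballxx.
  exact: ball_open.
exists (i y); case: xgetP => [_ -> [Az iz]|/(_ y)]; last by case.
have -> : xget 0 [set x | A x /\ i x = i y] = y.
  by case: xgetP => [z _ [Az' iz']|/(_ y)]; [apply: inji; rewrite ?inE|case].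
by move: xy; rewrite -ball_normE.
Qed.

Section WeakTopology.
Variables (R : realType) (K : numFieldType).
Hypothesis real_or_complex :
  K = R :> numFieldType \/ K = R[i]%C :> numFieldType.
Variable X : normedModType K.

(** The factor 2 stands in for norm attainment: the values at [a k] of the
    functionals in the dual unit ball have a supremum, and some value is at least
    half of it. *)
Lemma almost_norming_sequence (a : nat -> X) :
  exists z : nat -> dual X, forall k, dual_unit_ball (z k) /\
    forall f : dual X, dual_unit_ball f -> `|f (a k)| <= 2 * `|z k (a k)|.
Proof.
suff H k : exists z : dual X, dual_unit_ball z /\
    forall f : dual X, dual_unit_ball f -> `|f (a k)| <= 2 * `|z (a k)|.
  by have [z zP] := choice H; exists z.
pose S := [set `|f (a k)| | f in @dual_unit_ball K X].
have [||_ [z z1 <-] zS] :=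
  scalar_half_sup real_or_complex (S := S) (b := `|a k|).
- by exists `|(0 : dual X) (a k)|, 0 => // x; rewrite normr0.
- by move=> _ [f f1 <-]; rewrite normr_ge0 f1.
by exists z; split=> // f f1; apply: zS; exists f.
Qed.

(** A functional [g] in the dual unit ball changes by at most [|x - a k|] between
    [x] and [a k], and so does [z k], which vanishes at [x]. Hence
    [|g x| <= |x - a k| + 2 |z k (a k)| <= 3 |x - a k|], which is arbitrarily
    small. Some nonzero multiple of [f] is such a [g]. *)
Lemma almost_norming_total (a : nat -> X) (z : nat -> dual X) :
  (forall x (e : K), 0 < e -> exists k, `|x - a k| < e) ->
  (forall k, dual_unit_ball (z k) /\
     forall f : dual X, dual_unit_ball f -> `|f (a k)| <= 2 * `|z k (a k)|) ->
  forall x, (forall k, z k x = 0) -> forall f : dual X, f x = 0.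
Proof.
move=> adense zP x zx f.
have [C C0 fC] := dual_bounded f.
apply/eqP; apply: contraT => fx0.
pose g : dual X := C^-1 *: f.
have g1 : dual_unit_ball g.
  move=> y; rewrite /g dual_scaleE normrM gtr0_norm ?invr_gt0//.
  by rewrite ler_pdivrMl.
have gx0 : 0 < `|g x|.
  by rewrite normr_gt0 /g dual_scaleE mulf_neq0// invr_neq0// gt_eqF.
have [|k ak] := adense x (`|g x| / 3); first exact: divr_gt0.
have : `|g x| <= 3 * `|x - a k|.
  have {1}-> : x = (x - a k) + a k by rewrite subrK.
  rewrite raddfD addrC (le_trans (ler_normD _ _))//.
  rewrite (mulrSr 1 2) mulrDl mul1r lerD ?g1//.
  rewrite (le_trans ((zP k).2 _ g1))// ler_pM2l//.
  have -> : z k (a k) = - z k (x - a k) by rewrite raddfB/= zx sub0r opprK.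
  by rewrite normrN (zP k).1.
by move=> /le_lt_trans - /(_ (3 * (`|g x| / 3))); rewrite ltr_pM2l// => /(_ ak);
  rewrite mulrCA divff// mulr1 ltxx.
Qed.

Definition cylinder (z : nat -> dual X) n (y : X) (d : K) : set X :=
  [set x | forall j, (j < n)%N -> `|z j (x - y)| < d].

Lemma continuous_weak (f : dual X) : continuous (f : weak_topology X -> K^o).
Proof.
move=> x.
have FF := @nbhs_filter (weak_topology X) x.
have /(cvg_sup _ _ FF)/(_ f) cf :
  @nbhs (weak_topology X) (weak_topology X) x `=>` @nbhs _ (weak_topology X) x.
  by [].
apply: cvg_trans (@initial_continuous _ _ (f : X -> K^o) x).
exact: cvg_app cf.
Qed.

Lemma cylinderS z n y d : cylinder z n.+1 y d =
  cylinder z n y d `&` [set x | `|z n (x - y)| < d].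
Proof.
apply/seteqP; split=> x /=.
  by move=> zx; split=> [j jn|]; apply: zx => //; exact: ltnW.
by move=> [zx zn] j; rewrite ltnS leq_eqVlt => /predU1P[->//|]; exact: zx.
Qed.

(** Stated for an arbitrary [h] so as to give both the weak openness of cylinders
    ([h] the identity of the weak topology) and the norm openness of their
    preimages under the iterates of an operator. *)
Lemma cylinder_open_of (T : topologicalType) (h : T -> X)
    (z : nat -> dual X) n y d :
  (forall j, continuous (z j \o h : T -> K^o)) ->
  open (h @^-1` cylinder z n y d).
Proof.
move=> ch; elim: n => [|n IHn].
  rewrite (_ : _ @^-1` _ = setT); first exact: openT.
  by apply/seteqP.
rewrite cylinderS preimage_setI; apply: openI => //.
rewrite (_ : _ @^-1` _ = [set t | `|(z n \o h) t - z n y| < d]).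
  by apply: norm_lt_open => t; apply: cvgB; [exact: ch|exact: cvg_cst].
by apply/seteqP; split=> t /=; rewrite raddfB.
Qed.

Lemma cylinder_weakly_open z n y d : weakly_open (cylinder z n y d).
Proof.
apply: (@cylinder_open_of (weak_topology X) id) => j.
exact: continuous_weak.
Qed.

Hypothesis X_reflexive : reflexive_space X.
Variable z : nat -> dual X.
Hypothesis z_total :
  forall x, (forall k, z k x = 0) -> forall f : dual X, f x = 0.

(* These are the linear combinations of the [z j], described by the estimate that
   is wanted of them instead of by their coefficients. *)
Let controlled : set (dual X) := [set f | exists n C, 0 <= C /\
  forall x e, (forall j, (j < n)%N -> `|z j x| <= e) -> 0 <= e ->
    `|f x| <= C * e].

Let controlled0 : controlled 0.
Proof. by exists 0%N, 0; split=> // x e _ _; rewrite normr0 mul0r. Qed.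

Let controlledD f g : controlled f -> controlled g -> controlled (f + g).
Proof.
move=> [n [C [C0 fC]]] [m [D [D0 gD]]]; exists (maxn n m), (C + D).
split=> [|x e ze e0]; first exact: addr_ge0.
rewrite dual_addE mulrDl (le_trans (ler_normD _ _))// lerD//.
  by apply: fC => // j jn; apply: ze; rewrite leq_max jn.
by apply: gD => // j jm; apply: ze; rewrite leq_max jm orbT.
Qed.

Let controlledZ c f : controlled f -> controlled (c *: f).
Proof.
move=> [n [C [C0 fC]]]; exists n, (`|c| * C).
split=> [|x e ze e0]; first by rewrite mulr_ge0.
by rewrite dual_scaleE normrM -mulrA ler_wpM2l// fC.
Qed.

Let controlled_total x :
  (forall g, controlled g -> g x = 0) -> forall f : dual X, f x = 0.
Proof.
move=> gx; apply: z_total => k; apply: gx; exists k.+1, 1.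
by split=> // y e ze e0; rewrite mul1r ze.
Qed.

(** On a bounded set, the weak neighbourhoods of [w] are generated by the
    cylinders over the single sequence [z]: each functional is uniformly close
    there to one that finitely many [z j] control. *)
Theorem bounded_weak_nbhs (W : set X) (w : X) (m : K) :
  weakly_open W -> W w ->
  exists n d, 0 < d /\ cylinder z n w d `&` [set x | `|x| <= m] `<=` W.
Proof.
move=> Wo Ww.
(* The claim says that the filter [F] generated by the traces of the cylinders
   converges weakly to [w]; by definition of the weak topology, this can be
   checked on each functional separately. *)
pose F : set_system X := [set A | exists n d, 0 < d /\
  cylinder z n w d `&` [set x | `|x| <= m] `<=` A].
have FF : Filter F.
  split.
  - by exists 0%N, 1; split.
  - move=> A B [n [d [d0 dA]]] [p [e [e0 eB]]].
    have [c [c0 cd ce]] : exists c : K, [/\ 0 < c, c <= d & c <= e].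
      case: (real_leP (gtr0_real d0) (gtr0_real e0)) => [de|/ltW ed].
        by exists d.
      by exists e.
    exists (maxn n p), c; split=> // x [xc xm].
    split; [apply: dA|apply: eB]; split=> // j jn.
      by apply: lt_le_trans cd; apply: xc; rewrite leq_max jn.
    by apply: lt_le_trans ce; apply: xc; rewrite leq_max jn orbT.
  - by move=> A B AB [n [d [d0 dA]]]; exists n, d; split=> // x /dA/AB.
suff : F `=>` @nbhs _ (weak_topology X) w by apply; apply: open_nbhs_nbhs.
apply/(cvg_sup _ _ FF) => f A /= [_ [[B Bo <-] Bw] sBA].
have [e e0 eB] : exists2 e : K, 0 < e & ball (f w : K^o) e `<=` B.
  by apply/nbhs_ballP; apply: open_nbhs_nbhs.
(* [b] bounds [|x - w|] strictly. Half of [e] pays for replacing [f] by [g], the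
   other half for [g] on the cylinder; [C + 1] because [C] may be 0. *)
pose b := `|m| + `|w| + 1.
have b0 : 0 < b by rewrite ltr_wpDl// addr_ge0.
have e20 : 0 < e / 2 by rewrite divr_gt0.
have [g [n [C [C0 gC]]] fg] := reflexive_approximation real_or_complex
  X_reflexive controlled0 controlledD controlledZ controlled_total f
  (divr_gt0 e20 b0).
have C10 : 0 < C + 1 by rewrite ltr_wpDl.
exists n, (e / 2 / (C + 1)); split; first by rewrite divr_gt0.
move=> x [xw xm]; apply: sBA; apply: eB; rewrite -ball_normE/= distrC.
rewrite -raddfB /= -[X in `|X|](subrK (g (x - w))).
rewrite (le_lt_trans (ler_normD _ _))//.
rewrite [ltRHS]splitr ltr_leD//.
  apply: le_lt_trans (fg _) _.
  rewrite -mulrA gtr_pMr// mulrC ltr_pdivrMr// mul1r.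
  rewrite (le_lt_trans (ler_normB _ _))// /b ltr_pwDr// lerD2r.
  by rewrite (le_trans xm)// real_ler_norm// ger0_real// (le_trans _ xm).
apply: (le_trans (gC _ (e / 2 / (C + 1)) _ _)).
- by move=> j jn; apply/ltW/xw.
- by rewrite ltW// divr_gt0.
by rewrite mulrCA ger_pMr// ler_pdivrMr// mul1r lerDl.
Qed.

End WeakTopology.

(** * Baire category *)

Section Baire.
Variables (K : numFieldType) (X : completeNormedModType K).
Hypothesis archimedean : forall c : K, exists n : nat, `|c| < n%:R.

Let small_inv (e : K) : 0 < e -> exists n : nat, n.+1%:R^-1 < e.
Proof.
move=> e0; have [n en] := archimedean e^-1; exists n.
rewrite invf_plt ?posrE// -[ltLHS]gtr0_norm ?invr_gt0//.
by rewrite (lt_trans en)// ltr_nat.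
Qed.

Let closed_ball_sub_open (U : set X) x (c : K) : open U -> U x -> 0 < c ->
  exists s, [/\ 0 < s, s <= c & forall y, `|x - y| <= s -> U y].
Proof.
move=> Uo Ux c0.
have /nbhs_ballP[e /= e0 eU] : nbhs x U by apply: open_nbhs_nbhs.
have e20 : 0 < e / 2 by rewrite divr_gt0.
have Ue s y : s <= e / 2 -> `|x - y| <= s -> U y.
  move=> se xy; apply: eU; rewrite -ball_normE/=.
  rewrite (le_lt_trans xy)// (le_lt_trans se)// ltr_pdivrMr//.
  by rewrite ltr_pMr// ltr1n.
case: (real_leP (gtr0_real e20) (gtr0_real c0)) => [ec|/ltW ce].
  by exists (e / 2); split=> // y; exact: Ue.
by exists c; split=> // y; exact: Ue.
Qed.

(** The usual proof by nested closed balls, over any scalar field in which the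
    radii [1 / (n + 1)] tend to 0; in particular over the complex numbers. *)
Theorem archimedean_baire (F : nat -> set X) :
  (forall i, open (F i) /\ dense (F i)) -> dense (\bigcap_i F i).
Proof.
move=> odF D [a0 Da0] Do.
have [r0 [r00 _ r0D]] := closed_ball_sub_open Do Da0 ltr01.
have refine (nar : nat * (X * K)) : exists bs : X * K, 0 < nar.2.2 ->
    [/\ 0 < bs.2, bs.2 <= nar.1.+1%:R^-1 &
      forall y, `|bs.1 - y| <= bs.2 ->
        F nar.1 y /\ `|nar.2.1 - y| <= nar.2.2].
  case: nar => n [a r] /=.
  have [r_gt0|] := boolP (0 < r); last by exists (a, r).
  have [||b [ab Fb]] := (odF n).2 (ball a r).
  - by exists a; exact: ballxx.
  - exact: ball_open.
  have UO : open (ball a r `&` F n).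
    by apply: openI; [exact: ball_open|exact: (odF n).1].
  have [|s [s0 sn sU]] :=
    closed_ball_sub_open (c := n.+1%:R^-1) UO (conj ab Fb).
    by rewrite invr_gt0.
  exists (b, s) => _; split=> // y /sU[+ Fy].
  by rewrite -ball_normE => /ltW.
have [f fP] := choice refine.
pose fix ar n := if n is m.+1 then f (m, ar m) else (a0, r0).
pose a n := (ar n).1; pose r n := (ar n).2.
have r_gt0 n : 0 < r n.
  by elim: n => [//|n IHn]; have [] := fP (n, ar n) IHn.
have rle n : r n.+1 <= n.+1%:R^-1 by have [] := fP (n, ar n) (r_gt0 n).
have step n y : `|a n.+1 - y| <= r n.+1 -> F n y /\ `|a n - y| <= r n.
  by have [_ _] := fP (n, ar n) (r_gt0 n); exact.
have nested n m y : (n <= m)%N -> `|a m - y| <= r m -> `|a n - y| <= r n.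
  move=> /subnK <-; elim: (m - n)%N => [//|k IHk].
  by rewrite addSn => /step[_]; exact: IHk.
have aa n m : (n <= m)%N -> `|a n - a m| <= r n.
  by move=> nm; apply: nested nm _; rewrite subrr normr0 ltW.
have : cvg (a @ \oo).
  apply: cauchy_cvg; apply: cauchy_exP => e e0.
  have [n ne] := small_inv e0.
  exists (a n.+1); exists n.+1 => // m /= nm; rewrite -ball_normE/=.
  by rewrite (le_lt_trans (aa _ _ nm))// (le_lt_trans (rle n)).
move=> /cvg_ex[l al].
have in_ball n : `|a n - l| <= r n.
  rewrite real_leNgt ?normr_real ?gtr0_real//; apply/negP => rl.
  have e0 : 0 < `|a n - l| - r n by rewrite subr_gt0.
  have /cvgrPdist_lt/(_ _ e0)[N _ NP] := al.
  have := NP (maxn N n) (leq_maxl _ _) => /=.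
  rewrite ltrBrDr => /lt_le_trans/(_ (ler_distD (a (maxn N n)) _ _)).
  rewrite addrC [`|l - _|]distrC ltrD2r => /lt_geF.
  by rewrite aa// leq_maxr.
exists l; split; first by apply: r0D; exact: (in_ball 0%N).
by move=> n _; have [] := step n l (in_ball n.+1).
Qed.

End Baire.

(** * Hypercyclic vectors *)

Section Hypercyclicity.
Variables (K : numFieldType) (X : normedModType K) (T : {linear X -> X}).

Lemma iter_linearZ n c x : iter n T (c *: x) = c *: iter n T x.
Proof. by elim: n => //= n ->; rewrite linearZ. Qed.

Lemma iter_continuous n : continuous T -> continuous (iter n T).
Proof.
move=> cT; elim: n => [|n IHn] x; first exact: cvg_id.
by apply: continuous_comp; [exact: IHn|exact: cT].
Qed.

(** By linearity, transitivity on the unit ball transfers to the ball of radius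
    [c]: apply it to [G / c] and to the cylinder scaled by [1 / c]. *)
Lemma ball_transitive_scaled (m : nat) (z : nat -> dual X) :
  (forall G W : set X, open G -> G `&` Ball X 1 !=set0 ->
    weakly_open W -> W `&` Ball X 1 !=set0 ->
    exists i x, [/\ G x, `|x| <= 1, W (iter i T x) & `|iter i T x| <= m%:R]) ->
  forall (G : set X) n y d (c : K), 0 < c ->
  open G -> (exists2 x, G x & `|x| <= c) -> 0 < d -> `|y| <= c ->
  exists i x, [/\ G x, `|x| <= c, cylinder z n y d (iter i T x) &
    `|iter i T x| <= c * m%:R].
Proof.
move=> BT G n y d c c0 Go [x0 Gx0 x0c] d0 yc.
have cN0 : c != 0 by rewrite gt_eqF.
have normV x : `|c^-1 *: x| = `|x| / c.
  by rewrite normrZ gtr0_norm ?invr_gt0// mulrC.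
have [||||i [x [Gx x1 Wx xm]]] := BT ( *:%R c @^-1` G)
    (cylinder z n (c^-1 *: y) (d / c)).
- by apply: open_comp => // x _; exact: scaler_continuous.
- exists (c^-1 *: x0); split.
    by rewrite /preimage/= scalerA mulfV// scale1r.
  by rewrite /Ball/= normV ler_pdivrMr// mul1r.
- exact: cylinder_weakly_open.
- exists (c^-1 *: y); split.
    by move=> j _; rewrite subrr raddf0 normr0 divr_gt0.
  by rewrite /Ball/= normV ler_pdivrMr// mul1r.
have normZ u : `|c *: u| = c * `|u| by rewrite normrZ gtr0_norm.
exists i, (c *: x); split=> //.
- by rewrite normZ -[leRHS]mulr1 ler_pM2l.
- move=> j jn.
  have -> : iter i T (c *: x) - y = c *: (iter i T x - c^-1 *: y).
    by rewrite scalerBr scalerA mulfV// scale1r iter_linearZ.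
  by rewrite linearZ normrM gtr0_norm// mulrC -ltr_pdivlMr// Wx.
- by rewrite iter_linearZ normZ ler_pM2l.
Qed.

End Hypercyclicity.

Theorem theorem1p2 (R : realType) (K : numFieldType)
    (K_real_or_complex : K = R :> numFieldType \/ K = R[i]%C :> numFieldType)
    (X : completeNormedModType K)
    (X_separable : separable X)
    (X_reflexive : reflexive_space X)
    (T : {linear X -> X})
    (T_bounded : bounded_near T (nbhs (0 : X)))
    (transitive : forall G W : set X,
      open G -> G !=set0 -> weakly_open W -> W !=set0 ->
      exists n : nat, (iter n T @` G) `&` W !=set0)
    (ball_transitive : exists M : int, forall G W : set X,
      open G -> G `&` Ball X 1 !=set0 ->
      weakly_open W -> W `&` Ball X 1 !=set0 ->
      exists n : nat,
        (iter n T @` (G `&` Ball X 1)) `&` W `&` Ball X M !=set0) :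
  weakly_hypercyclic T.
Proof.
have archi := scalar_archimedean K_real_or_complex.
have Tn n : continuous (iter n T).
  by apply: iter_continuous; exact: bounded_linear_continuous.
have [a adense] := separable_dense_sequence X_separable.
have [z zP] := almost_norming_sequence K_real_or_complex a.
have ztot := almost_norming_total adense zP.
have [M BM] := ball_transitive; pose m := `|M|%N.
have BT (G W : set X) : open G -> G `&` Ball X 1 !=set0 ->
    weakly_open W -> W `&` Ball X 1 !=set0 ->
    exists i x, [/\ G x, `|x| <= 1, W (iter i T x) & `|iter i T x| <= m%:R].
  move=> Go G1 Wo W1.
  have [i [_ [[[x [Gx x1] <-] Wx] xM]]] := BM G W Go G1 Wo W1.
  exists i, x; split=> //; apply: le_trans xM _.
  by rewrite -[m%:R]/((m%:Z)%:~R) ler_int lez_abs.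
(* Points outside the unit ball are admitted to make each set dense in all of
   [X]; the vector found in the end has norm less than 1. The bound [+ 1] turns
   the ball of radius [(N + 1) m] into a subset of an open one. *)
pose hitting (nNk : nat * nat * nat) : set X :=
  let: (n, N, k) := nNk in [set x | `|a k| <= N.+1%:R -> 1 < `|x| \/
    exists i, cylinder z n (a k) n.+1%:R^-1 (iter i T x) /\
      `|iter i T x| < N.+1%:R * m%:R + 1].
pose F i := if unpickle i is Some nNk then hitting nNk else setT.
have Fod i : open (F i) /\ dense (F i).
  rewrite /F; case: unpickle => [[[n N] k]|]; last first.
    by split; [exact: openT|move=> G [x Gx] _; exists x].
  have [akN|akN] := boolP (`|a k| <= N.+1%:R); last first.
    have -> : hitting (n, N, k) = setT.
      by apply/seteqP; split=> // x _ /=; rewrite (negPf akN).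
    by split; [exact: openT|move=> G [x Gx] _; exists x].
  split.
    rewrite (_ : hitting _ = [set x | 1 < `|x|] `|`
      \bigcup_l (iter l T @^-1` cylinder z n (a k) n.+1%:R^-1 `&`
        [set x | `|iter l T x| < N.+1%:R * m%:R + 1])); last first.
      apply/seteqP; split=> x /=.
        by move=> /(_ akN)[|[l [? ?]]]; [left|right; exists l].
      by move=> [x1|[l _ [? ?]]] _; [left|right; exists l].
    apply: openU; first exact: norm_gt_open.
    apply: bigcup_open => l _; apply: openI; last exact: norm_lt_open.
    apply: cylinder_open_of => j x.
    by apply: continuous_comp; [exact: Tn|exact: dual_continuous].
  move=> G [x0 Gx0] Go.
  have [x01|x01] := boolP (`|x0| <= N.+1%:R).
    have [|||||l [x [Gx _ zx xm]]] := ball_transitive_scaled z BT n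
      (G := G) (y := a k) (d := n.+1%:R^-1) (c := N.+1%:R).
    - by [].
    - by [].
    - by exists x0.
    - by rewrite invr_gt0.
    - by [].
    exists x; split=> // _; right; exists l; split=> //.
    by rewrite (le_lt_trans xm)// ltrDl.
  exists x0; split=> // _; left.
  rewrite -real_ltNge ?normr_real ?realn// in x01.
  by rewrite (le_lt_trans _ x01)// ler1n.
have [||x [x1 xF]] := archimedean_baire archi Fod (O := ball 0 1).
- by exists 0; exact: ballxx.
- exact: ball_open.
move: x1; rewrite -ball_normE/= sub0r normrN => x1.
exists x => W [w Ww] Wo.
(* The centre [a k] of the cylinder is chosen within 1 of [w], so the radius is
   taken to be at least [|w| + 1]. *)
have [N wN] := archi (`|w| + 1).
pose C : K := N.+1%:R * m%:R + 1.
have [n [d [d0 dW]]] :=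
  bounded_weak_nbhs K_real_or_complex X_reflexive ztot C Wo Ww.
have [p pd] : exists p : nat, 2 / d < p%:R.
  by have [p] := archi (2 / d); rewrite gtr0_norm ?divr_gt0//; exists p.
(* One index serves both as the number of functionals and as the precision. *)
pose n' := maxn n p.
have n'd : n'.+1%:R^-1 < d / 2.
  rewrite invf_plt ?posrE ?divr_gt0// invf_div (lt_le_trans pd)// ler_nat.
  by rewrite leqW// leq_maxr.
have [k wk] : exists k, `|w - a k| < n'.+1%:R^-1.
  by apply: adense; rewrite invr_gt0.
have akN : `|a k| <= N.+1%:R.
  rewrite -[a k](subKr w) (le_trans (ler_normB _ _))//.
  rewrite (@le_trans _ _ (`|w| + 1))//.
    rewrite lerD2l (le_trans (ltW wk))// invf_le1// ler1n//.
  rewrite -[leLHS]ger0_norm ?addr_ge0// (le_trans (ltW wN))// ler_nat//.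
have := xF (pickle (n', N, k)) I; rewrite /F pickleK => /(_ akN)[|].
  by move=> /(lt_trans x1); rewrite ltxx.
move=> [i [zx xC]]; exists (iter i T x); split; last by exists i.
apply: dW; split; last exact: ltW.
move=> j jn; have -> : iter i T x - w = (iter i T x - a k) - (w - a k).
  by rewrite opprB addrA subrK.
rewrite raddfB (le_lt_trans (ler_normB _ _))// [ltRHS]splitr ltrD//.
  by rewrite (lt_trans _ n'd)// zx// (leq_trans jn) ?leq_maxl.
by rewrite (le_lt_trans ((zP j).1 _))// (lt_trans wk).
Qed.
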